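(* There exists a function $\varepsilon:\mathbb{N}\to[0,\infty)$ with $\varepsilon(m)\to 0$ as $m\to\infty$ such that the following holds. Let $A$ and $B$ be disjoint finite sets with $|A|=a$ and $|B|=b$, let $K_{A,B}$ denote the complete bipartite graph with color classes $A$ and $B$, and let $D$ be a bipartite demand graph on $A\cup B$ with color classes $A$ and $B$ (i.e., every edge of $D$ joins a vertex of $A$ to a vertex of $B$). If $d_D(x)\le (1-\varepsilon(b))\,b/4$ for all $x\in A$ and $d_D(y)\le (1-\varepsilon(a))\,a/4$ for all $y\in B$, then $D$ is resolvable in $K_{A,B}$.
   Context: A demand graph on the vertex set of a simple base graph $G$ is a loopless multigraph $D$ with $V(D)=V(G)$ (parallel edges allowed). $D$ is resolvable in $G$ if one can assign to each edge of $D$ (counted with multiplicity) a path in $G$ joining the two endpoints of that edge, such that the assigned paths are pairwise edge-disjoint. Degrees $d_D$ count edges with multiplicity. The paper states the degree bounds as $(1-o(1))b/4$ and $(1-o(1))a/4$; the function $\varepsilon$ formalizes this $o(1)$ term. *)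

(* Defs.v *)
From mathcomp Require Import all_boot.

Set Implicit Arguments.
Unset Strict Implicit.
Unset Printing Implicit Defensive.

Record sgraph (V : finType) := SGraph {
  adj : rel V;
  adj_sym : symmetric adj;
  adj_irrefl : irreflexive adj
}.

(* Edges form a finite type, so distinct elements of [dedge D] may have the
   same ends: these are the parallel edges. *)
Record demand_graph (V : finType) := DemandGraph {
  dedge : finType;
  dends : dedge -> {set V};
  dends_loopless : forall e, #|dends e| = 2
}.

Definition degree (V : finType) (D : demand_graph V) (x : V) : nat :=
  #|[set e : dedge D | x \in dends e]|.

(* A pair [(u, p)] stands for the path with successive vertices [u :: p];
   a path does not repeat vertices. *)
Definition is_gpath (V : finType) (G : sgraph V) (w : V * seq V) : bool :=
  path (adj G) w.1 w.2 && uniq (w.1 :: w.2).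

Definition gpath_ends (V : finType) (w : V * seq V) : {set V} :=
  [set w.1; last w.1 w.2].

Definition gpath_edges (V : finType) (w : V * seq V) : seq {set V} :=
  pairmap (fun x y => [set x; y]) w.1 w.2.

Definition resolvable (V : finType) (G : sgraph V) (D : demand_graph V) : Prop :=
  exists P : dedge D -> V * seq V,
    (forall e, is_gpath G (P e) /\ gpath_ends (P e) = dends e) /\
    (forall e f, e != f -> [disjoint gpath_edges (P e) & gpath_edges (P f)]).

Definition biadj (V : finType) (A B : {set V}) : rel V := fun x y =>
  (x \in A) && (y \in B) || (x \in B) && (y \in A).

Lemma biadj_sym (V : finType) (A B : {set V}) : symmetric (biadj A B).
Proof. by move=> x y; rewrite /biadj orbC andbC [in X in _ || X]andbC. Qed.

Lemma biadj_irrefl (V : finType) (A B : {set V}) :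
  [disjoint A & B] -> irreflexive (biadj A B).
Proof.
move=> dAB x; rewrite /biadj [in X in _ || X]andbC orbb.
by case: (boolP (x \in A)) => //= /(disjointFr dAB).
Qed.

Definition complete_bipartite (V : finType) (A B : {set V})
    (dAB : [disjoint A & B]) : sgraph V :=
  SGraph (biadj_sym A B) (biadj_irrefl dAB).

Definition bipartite_demand (V : finType) (A B : {set V})
    (D : demand_graph V) : Prop :=
  forall e : dedge D, exists x y,
    [/\ x \in A, y \in B & dends e = [set x; y]].

(* Main.v *)
(* By symmetry let |A| <= |B|.  Every demand edge xy is routed along a path
   x u v y with u in B and v in A.  Split B into two halves and choose u in the
   half not containing y, with distinct u for the edges at a given x and about
   |A|/4 edges for each u (Koenig's edge colouring theorem).  The pairs uy then
   form a bipartite multigraph on B of maximum degree about |A|/2, and v has to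
   be a proper edge colouring of it with colours in A, avoiding for the edge uy
   the colours x' such that x'u or x'y is already used: about |A|/2 colours
   remain, so Galvin's list colouring theorem applies. *)

Require Import Defs.
From mathcomp Require Import all_boot zify.

Set Implicit Arguments.
Unset Strict Implicit.
Unset Printing Implicit Defensive.

(** * Edge colouring of bipartite multigraphs: Koenig's theorem *)

Section BipartiteEdgeColouring.

Local Open Scope nat_scope.

Variables (E : finType) (X Y : eqType) (p : E -> X) (q : E -> Y).

(** The elements of [E] are the edges of a bipartite multigraph with ends [p e] and [q e]. [share]
    is adjacency in its line graph, made reflexive. *)
Definition share : rel E := fun e f => (p e == p f) || (q e == q f).

Lemma share_sym : symmetric share.
Proof. by move=> e f; rewrite /share eq_sym [q e == _]eq_sym. Qed.

Definition proper_on (C : Type) (S : {set E}) (k : E -> C) : Prop :=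
  {in S &, forall e f, k e = k f -> share e f -> e = f}.

Lemma card_le_interval (T : {set E}) (k : E -> nat) m n :
  {in T &, injective k} -> {in T, forall e, m <= k e < n} -> #|T| <= n - m.
Proof.
move=> inj rng; rewrite cardE -(size_map k) -(size_iota m (n - m)).
apply: uniq_leq_size => [|i /mapP[e]].
  by rewrite map_inj_in_uniq ?enum_uniq // => e f;
     rewrite !mem_enum; apply: inj.
rewrite mem_enum => /rng /andP[le_m lt_n] ->.
by rewrite mem_iota le_m /=; lia.
Qed.

Lemma missing_colour (T : {set E}) (k : E -> nat) n :
  #|T| < n -> exists2 i, i < n & {in T, forall e, k e != i}.
Proof.
move=> ltTn; have [/allP sub|] := boolP (all (mem (map k (enum T))) (iota 0 n)).
  have := uniq_leq_size (iota_uniq 0 n) sub.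
  by rewrite size_map size_iota -cardE leqNgt ltTn.
case/allPn=> i; rewrite mem_iota /= => lt_in /negP i_notin.
exists i => // e eT; apply/eqP => ke; apply: i_notin.
by rewrite -ke; apply: map_f; rewrite mem_enum.
Qed.

(* A Kempe chain: [i] is missing at the first end of [e0] and [j] at the
   second.  The chain leaves the second end along [i] and enters each first
   end along [i], hence it never reaches the first end of [e0]. *)
Lemma kempe_swap (S : {set E}) (k : E -> nat) (n i j : nat) (e0 : E) :
  i < n -> j < n ->
  {in S, forall e, k e < n} -> proper_on S k ->
  {in S, forall e, p e = p e0 -> k e <> i} ->
  {in S, forall e, q e = q e0 -> k e <> j} ->
  exists k' : E -> nat,
    [/\ {in S, forall e, k' e < n}, proper_on S k',
        {in S, forall e, p e = p e0 -> k' e <> i} &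
        {in S, forall e, q e = q e0 -> k' e <> i}].
Proof.
move=> lt_in lt_jn kn kP pi qj.
pose step : rel E := fun f g => [&& f \in S, g \in S &
  [&& k f == i, k g == j & p f == p g] ||
  [&& k f == j, k g == i & q f == q g]].
pose Z := [set g in S |
  [exists f in S, [&& k f == i, q f == q e0 & connect step f g]]].
have Zstep f g : f \in Z -> step f g -> g \in Z.
  rewrite !inE => /andP[fS /existsP[h /and4P[hS hi hq hc]]] st.
  have /and3P[_ -> _] := st; apply/existsP; exists h.
  by rewrite hS hi hq (connect_trans hc (connect1 st)).
have Zstart f : f \in S -> k f = i -> q f = q e0 -> f \in Z.
  move=> fS fi fq; rewrite inE fS; apply/existsP; exists f.
  by rewrite fS fi fq !eqxx connect0.
have Zprev g : g \in Z -> (k g = i /\ q g = q e0) \/ exists2 f, f \in Z & step f g.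
  rewrite inE => /andP[gS /existsP[h /and4P[hS /eqP hi /eqP hq /connectP[s]]]].
  case/lastP: s => [|s f]; first by move=> _ ->; left.
  rewrite rcons_path last_rcons => /andP[hs st] gf; right.
  exists (last h s); last by rewrite gf.
  have /and3P[lS _ _] := st; rewrite inE lS.
  apply/existsP; exists h; rewrite hS hi hq !eqxx /=.
  by apply/connectP; exists s.
have ZS g : g \in Z -> g \in S by rewrite inE => /andP[].
have Zcol g : g \in Z -> k g = i \/ k g = j.
  by move=> /Zprev[[->]|[f _ /and3P[_ _ /orP[]/and3P[_ /eqP -> _]]]]; auto.
have Zj g : g \in Z -> k g = j -> i <> j ->
    exists f, [/\ f \in Z, k f = i & p f = p g].
  move=> gZ gj ij; case: (Zprev g gZ) => [[]|[f fZ]]; first by rewrite gj => /esym.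
  case/and3P=> _ _ /orP[]/and3P[/eqP fi /eqP gi /eqP fg]; first by exists f.
  by case: ij; rewrite -gi.
have Zi g : g \in Z -> k g = i -> i <> j ->
    q g = q e0 \/ exists f, [/\ f \in Z, k f = j & q f = q g].
  move=> gZ gi ij; case: (Zprev g gZ) => [[]|[f fZ]]; first by left.
  case/and3P=> _ _ /orP[]/and3P[/eqP fi /eqP gj /eqP fg]; last by right; exists f.
  by case: ij; rewrite -gi.
have [eq_ij|/eqP ij] := eqVneq i j.
  by exists k; split=> //; rewrite eq_ij.
(* Z is a union of components of the subgraph of colours [i] and [j]. *)
have Zclosed g h : g \in Z -> h \in S -> share g h -> k h = i \/ k h = j -> h \in Z.
  move=> gZ hS gh hc; have gS := ZS _ gZ.
  have same f : f \in Z -> k f = k h -> share f h -> h \in Z.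
    by move=> fZ fh /(kP _ _ (ZS _ fZ) hS fh) <-.
  case: (Zcol g gZ) hc => gc [] hc; try by apply: (same g) => //; rewrite gc.
  - case/orP: gh => gh; first by apply: Zstep gZ _; rewrite /step gS hS gc hc gh !eqxx.
    (* An [i]-edge [g] of the chain either leaves [q e0], where colour [j] is missing, or was
       entered from a [j]-edge at its second end, which must be [h]. *)
    case: (Zi g gZ gc ij) => [gq|[f [fZ fj fg]]].
      by case: (qj h hS) => //; rewrite -gq (eqP gh).
    by apply: (same f) => //; rewrite ?fj ?hc // /share fg gh orbT.
  - case/orP: gh => gh; last first.
      by apply: Zstep gZ _; rewrite /step gS hS gc hc gh !eqxx orbT.
    case: (Zj g gZ gc ij) => f [fZ fi fg].
    by apply: (same f) => //; rewrite ?fi ?hc // /share fg gh.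
pose k' e := if e \in Z then (if k e == i then j else i) else k e.
exists k'; split.
- by move=> e eS; rewrite /k'; case: ifP => // _; [case: ifP | apply: kn].
- move=> e f eS fS; rewrite /k'.
  have [eZ|eZ] := boolP (e \in Z); have [fZ|fZ] := boolP (f \in Z).
  + move=> kef; apply: kP => //; move: kef.
    case: (Zcol e eZ) (Zcol f fZ) => -> [] -> //; rewrite eqxx.
      by case: eqP => // ji /esym.
    by case: eqP => // ji /esym.
  + move=> kef ef; case/negP: fZ; apply: Zclosed eZ _ ef _ => //.
    by rewrite -kef; case: ifP; auto.
  + move=> kef ef; case/negP: eZ; apply: (Zclosed f) => //.
      by rewrite share_sym.
    by rewrite kef; case: ifP; auto.
  + exact: kP.
(* Only a [j]-edge of [Z] could become an [i]-edge at [p e0], but the chain would have entered it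
   from an [i]-edge at [p e0]. *)
- move=> e eS ep; rewrite /k'; have [eZ|eZ] := boolP (e \in Z); last exact: pi.
  case: eqP => [_ /esym //|ei _].
  have [//|ej] := Zcol e eZ.
  have [f [fZ fi fp]] := Zj e eZ ej ij.
  by apply: (pi f (ZS _ fZ)) => //; rewrite fp.
- move=> e eS eq; rewrite /k'; have [eZ|eZ] := boolP (e \in Z).
    case: eqP => [_ /esym //|ei _].
    have [//|ej] := Zcol e eZ; exact: qj ej.
  by move=> ei; case/negP: eZ; apply: Zstart.
Qed.


Lemma proper_on_setU1 (C : Type) (S : {set E}) (k : E -> C) (e0 : E) (i : C) :
  proper_on S k -> {in S, forall e, share e0 e -> k e <> i} ->
  proper_on (e0 |: S) (fun e => if e == e0 then i else k e).
Proof.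
move=> kP ki e f; rewrite !in_setU1.
have [-> _|_ /= eS] := eqVneq e e0; have [-> _|_ /= fS] := eqVneq f e0 => //.
- by move=> /esym kf ef; case: (ki f fS ef).
- by move=> ke; rewrite share_sym => ef; case: (ki e eS ef).
- exact: kP.
Qed.

(** Induction on the number of edges: with [e0] removed, each end of [e0] misses some colour, and a
    Kempe swap makes one colour missing at both ends. *)
Lemma konig_edge_colouring (S : {set E}) (n : nat) :
  {in S, forall e, #|[set f in S | p f == p e]| <= n} ->
  {in S, forall e, #|[set f in S | q f == q e]| <= n} ->
  exists2 k : E -> nat, {in S, forall e, k e < n} & proper_on S k.
Proof.
move Em: #|S| => m; elim: m S Em => [|m IH] S Sm Sp Sq.
  move/eqP: Sm; rewrite cards_eq0 => /eqP ->.
  by exists (fun=> 0) => [e|e f]; rewrite inE.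
have [e0 e0S] : exists e0, e0 \in S by apply/set0Pn; rewrite -card_gt0 Sm.
have subS : S :\ e0 \subset S by apply: subsetDl.
have sub_deg (Z : eqType) (r : E -> Z) e :
    [set f in S :\ e0 | r f == r e] \subset [set f in S | r f == r e].
  by apply/subsetP => f; rewrite !inE => /andP[/andP[_ ->]].
have lt_deg (Z : eqType) (r : E -> Z) :
    #|[set f in S | r f == r e0]| <= n ->
    #|[set f in S :\ e0 | r f == r e0]| < n.
  apply: leq_trans; apply: proper_card; rewrite properE sub_deg /=.
  by apply/subsetPn; exists e0; rewrite !inE ?e0S !eqxx.
have [|||k kn kP] := IH (S :\ e0).
- by move: Sm; rewrite (cardsD1 e0) e0S => -[].
- move=> e /(subsetP subS) eS.
  exact: leq_trans (subset_leq_card (sub_deg _ p e)) (Sp e eS).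
- move=> e /(subsetP subS) eS.
  exact: leq_trans (subset_leq_card (sub_deg _ q e)) (Sq e eS).
have [i lt_in pi] := missing_colour k (lt_deg _ _ (Sp e0 e0S)).
have [j lt_jn qj] := missing_colour k (lt_deg _ _ (Sq e0 e0S)).
have [e eS ep|e eS eq|k' [k'n k'P k'p k'q]] := kempe_swap (e0 := e0) lt_in lt_jn kn kP.
- by apply/eqP/pi; rewrite inE eS ep eqxx.
- by apply/eqP/qj; rewrite inE eS eq eqxx.
exists (fun e => if e == e0 then i else k' e) => [e eS|].
  by have [//|ne] := eqVneq e e0; apply: k'n; rewrite !inE ne.
rewrite -(setD1K e0S); apply: proper_on_setU1 => // e eS /orP[]/eqP/esym.
  exact: k'p.
exact: k'q.
Qed.

(** * Kernels and Galvin's list colouring theorem *)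

(* In the line graph, first ends prefer small colours and second ends prefer
   large ones; a stable matching is then a kernel of this orientation. *)
Definition dominates (k : E -> nat) (f e : E) : bool :=
  (p e == p f) && (k f < k e) || (q e == q f) && (k e < k f).

(** Deferred acceptance: [T] holds the favourite edge of each first end. If two of them meet at a
    second end, the one of smaller colour is rejected, that is, deleted from [S], and induction
    applies. *)
Lemma stable_matching (k : E -> nat) (S : {set E}) :
  proper_on S k ->
  exists M : {set E}, [/\ M \subset S, {in M &, forall e f, share e f -> e = f} &
    {in S, forall e, e \notin M -> exists2 f, f \in M & dominates k f e}].
Proof.
move Em: #|S| => m; elim: m S Em => [|m IH] S Sm kP.
  exists set0; split; rewrite ?sub0set //.
  - by move=> e f; rewrite inE.
  - by move=> e eS; move/eqP: Sm; rewrite cards_eq0 => /eqP S0; rewrite S0 inE in eS.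
pose best e := [forall f in S, (p f == p e) ==> (k e <= k f)].
pose T := [set e in S | best e].
have [inj|] := boolP [forall e in T, forall f in T, share e f ==> (e == f)].
  exists T; split; first by apply/subsetP => e; rewrite inE => /andP[].
    move=> e f eT fT ef.
    by have /forall_inP/(_ f fT)/implyP/(_ ef)/eqP := forall_inP inj e eT.
  move=> e eS eT.
  case: (@arg_minnP _ e [pred f in S | p f == p e] k) => [|f /andP[fS fp] fmin].
    by rewrite /= eS eqxx.
  have fbest : best f.
    apply/forall_inP => g gS; apply/implyP => gp; apply: fmin.
    by rewrite /= gS (eqP gp) fp.
  exists f; first by rewrite inE fS fbest.
  rewrite /dominates eq_sym fp /= ltn_neqAle fmin ?andbT /= ?eS ?eqxx //.
  apply/orP; left; apply/eqP => kfe; case/negP: eT.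
  by rewrite -(kP _ _ fS eS kfe) ?inE ?fS ?fbest // /share fp.
case/forall_inPn => e1 e1T /forall_inPn[f1 f1T]; rewrite negb_imply.
have step e f : e \in T -> f \in T -> share e f -> k e < k f ->
    exists M : {set E}, [/\ M \subset S,
      {in M &, forall e f, share e f -> e = f} &
      {in S, forall e, e \notin M -> exists2 f, f \in M & dominates k f e}].
  rewrite !inE => /andP[eS ebest] /andP[fS fbest] ef kef.
  have /negbTE pef : p e != p f.
    apply/negP => pe; have := forall_inP fbest e eS.
    by rewrite pe /= leqNgt kef.
  move: ef; rewrite /share pef /= => qef.
  have [||M [MS Mm Mk]] := IH (S :\ e).
  - by move: Sm; rewrite (cardsD1 e) eS => -[].
  - by move=> g h /setD1P[_ gS] /setD1P[_ hS]; apply: kP.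
  have fSe : f \in S :\ e by rewrite !inE fS andbT; apply: contraTneq kef => ->; rewrite ltnn.
  exists M; split=> //; first exact: subset_trans MS (subsetDl _ _).
  move=> g gS gM; have [ge|ge] := eqVneq g e; last by apply: Mk; rewrite // !inE ge.
  (* The rejected [e] is dominated by [f]. If [f] is not in [M], its dominator [h] beats it at the
     second end, since [f] is a favourite, and so beats [e] as well. *)
  rewrite ge; have [fM|fM] := boolP (f \in M).
    by exists f => //; rewrite /dominates qef kef orbT.
  have [h hM hf] := Mk f fSe fM; exists h => //.
  have /setD1P[_ hS] := subsetP MS h hM.
  case/orP: hf => /andP[fh khf].
    by have := forall_inP fbest h hS; rewrite eq_sym fh /= leqNgt khf.
  by rewrite /dominates (eqP qef) fh (ltn_trans kef khf) orbT.
case/andP=> ef nef; case: (ltngtP (k e1) (k f1)) => kef.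
- exact: step ef kef.
- by apply: (step f1 e1) => //; rewrite share_sym.
- move: e1T f1T; rewrite !inE => /andP[e1S _] /andP[f1S _].
  by case/eqP: nef; apply: kP.
Qed.

(** Give a colour [i] to a kernel [M] of the edges whose lists contain [i], then delete [i] from all
    other lists. An edge that loses [i] also loses a dominator in [M], so the inequality
    persists. *)
Lemma kernel_list_colouring (C : finType) (k : E -> nat) (c0 : E -> C)
    (S : {set E}) (L : E -> {set C}) :
  proper_on S k ->
  {in S, forall e, #|[set f in S | dominates k f e]| < #|L e|} ->
  exists2 c : E -> C, {in S, forall e, c e \in L e} & proper_on S c.
Proof.
move: {2}#|S|.+1 (ltnSn #|S|) => m; elim: m S L => // m IH S L; rewrite ltnS => Sm kP SL.
have [->|/set0Pn[e0 e0S]] := eqVneq S set0.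
  by exists c0 => [e|e f]; rewrite inE.
have [i iL] : exists i, i \in L e0.
  by apply/set0Pn; rewrite -card_gt0; apply: leq_ltn_trans (SL e0 e0S).
pose T := [set e in S | i \in L e].
have TS : T \subset S by apply/subsetP => e; rewrite inE => /andP[].
have [e f /(subsetP TS) eS /(subsetP TS) fS|M [MT Mm Mk]] := @stable_matching k T.
  exact: kP.
have MS := subset_trans MT TS.
have [f0 f0M] : exists f0, f0 \in M.
  have [|e0M] := boolP (e0 \in M); first by exists e0.
  by have [|f fM _] := Mk e0 _ e0M; [rewrite inE e0S | exists f].
have [|||c cL cP] := IH (S :\: M) (fun e => L e :\ i).
- apply: leq_trans Sm; apply: proper_card; rewrite properE subsetDl /=.
  by apply/subsetPn; exists f0; rewrite ?(subsetP MS) // inE f0M.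
- by move=> e f /setDP[eS _] /setDP[fS _]; apply: kP.
- move=> e /setDP[eS eM].
  have sub : [set f in S :\: M | dominates k f e] \subset [set f in S | dominates k f e].
    by apply/subsetP => f; rewrite !inE => /andP[/andP[_ ->]].
  have := SL e eS; rewrite (cardsD1 i (L e)); have [iLe|iLe] := boolP (i \in L e); last first.
    by rewrite add0n; apply: leq_ltn_trans; apply: subset_leq_card.
  rewrite add1n ltnS; apply: leq_trans; apply: proper_card.
  rewrite properE sub /=; have [|f fM fe] := Mk e _ eM; first by rewrite inE eS.
  by apply/subsetPn; exists f; rewrite !inE ?fM ?fe ?(subsetP MS).
exists (fun e => if e \in M then i else c e) => [e eS|e f eS fS].
  have [eM|eM] := boolP (e \in M); first by have := subsetP MT e eM; rewrite inE => /andP[].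
  by have := cL e; rewrite !inE eM => /(_ eS)/andP[].
have [eM|eM] := boolP (e \in M); have [fM|fM] := boolP (f \in M).
- by move=> _; apply: Mm.
- by move=> cf; have := cL f; rewrite !inE fM -cf eqxx => /(_ fS).
- by move=> ce; have := cL e; rewrite !inE eM ce eqxx => /(_ eS).
- by apply: cP; rewrite inE ?eM ?fM.
Qed.

(** In a Koenig colouring with [n] colours, an edge of colour [t] has at most [t] dominators at its
    first end and [n - 1 - t] at its second, fewer than [n] in all. *)
Theorem galvin (C : finType) (n : nat) (L : E -> {set C}) :
  (forall e, #|[set f | p f == p e]| <= n) ->
  (forall e, #|[set f | q f == q e]| <= n) ->
  (forall e, n <= #|L e|) ->
  exists2 c : E -> C, forall e, c e \in L e &
    forall e f, c e = c f -> share e f -> e = f.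
Proof.
move=> degp degq nL.
have [e _|e _|k kn kP] := @konig_edge_colouring [set: E] n.
- by apply: leq_trans (degp e); apply: subset_leq_card; apply/subsetP => f; rewrite !inE.
- by apply: leq_trans (degq e); apply: subset_leq_card; apply/subsetP => f; rewrite !inE.
have [c0 _] : exists c0 : E -> C, forall e, c0 e \in L e.
  apply: (@fin_all_exists _ _ (fun e i => i \in L e)) => e; apply/set0Pn; rewrite -card_gt0.
  apply: leq_trans (nL e); apply: leq_trans (degp e).
  by apply/card_gt0P; exists e; rewrite inE.
have [e _|c cL cP] := @kernel_list_colouring C k c0 [set: E] L kP.
  apply: leq_trans (nL e); have ken := kn e (in_setT e).
  pose T1 := [set f | (p e == p f) && (k f < k e)].
  pose T2 := [set f | (q e == q f) && (k e < k f)].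
  have -> : [set f in [set: E] | dominates k f e] = T1 :|: T2.
    by apply/setP => f; rewrite !inE.
  apply: leq_ltn_trans (leq_card_setU _ _) _.
  have T1k : #|T1| <= k e - 0.
    apply: (@card_le_interval _ k) => [f g|f]; rewrite !inE; last by case/andP.
    move=> /andP[/eqP fp _] /andP[/eqP gp _] kfg.
    by apply: kP => //; rewrite /share -fp -gp eqxx.
  have T2k : #|T2| <= n - (k e).+1.
    apply: (@card_le_interval _ k) => [f g|f]; rewrite !inE; last first.
      by case/andP=> _ ->; apply: kn.
    move=> /andP[/eqP fp _] /andP[/eqP gp _] kfg.
    by apply: kP => //; rewrite /share -fp -gp eqxx orbT.
  lia.
by exists c => [e|e f]; [apply: cL | apply: cP].
Qed.

End BipartiteEdgeColouring.

(** * Choice of the inner vertices [u] and [v] of the paths *)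

Section Routing.

Variables (E V : finType) (x y : E -> V) (d : nat).

Lemma subset_of_card (B : {set V}) (m : nat) :
  m <= #|B| -> exists2 H : {set V}, H \subset B & #|H| = m.
Proof.
move=> le_mB; exists [set z in take m (enum B)].
  by apply/subsetP => z; rewrite inE => /mem_take; rewrite mem_enum.
rewrite cardsE; have /card_uniqP -> : uniq (take m (enum B)).
  by apply: take_uniq; apply: enum_uniq.
by rewrite size_take -cardE; case: ltngtP le_mB.
Qed.

(* Cut the edges with [y e] in a given half into blocks of size [#|B|./2] and
   colour the bipartite graph with ends [x e] and the block of [e]: a colour is
   used once at each [x e], and at most once per block. *)
Lemma balanced_crossing (B : {set V}) :
  (forall e, y e \in B) ->
  (forall w, #|[set e | y e == w]| <= d) ->
  (forall e, #|[set f | x f == x e]| <= #|B|./2) ->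
  d <= #|B|./2 ->
  exists (H : {set V}) (u : E -> V),
    [/\ forall e, u e \in B, forall e, (u e \in H) = (y e \notin H),
        forall e f, u e = u f -> x e = x f -> e = f &
        forall w, #|[set e | u e == w]| <= d.+1].
Proof.
set h := #|B|./2 => yB yd xh dh.
have hB : h <= #|B| <= h.*2.+1 by rewrite /h; lia.
have [H HB Hh] := subset_of_card (proj1 (andP hB)).
pose side e := y e \in H.
pose half b := if b then H else B :\: H.
have half_card b : h <= #|half b| <= h.+1.
  by case: b; rewrite /half ?cardsDS // Hh; lia.
have half_mem b w : w \in half b -> (w \in B) && ((w \in H) == b).
  case: b; rewrite /half; first by move=> wH; rewrite wH (subsetP HB).
  by rewrite inE => /andP[/negbTE -> ->].
pose on_side b := [set e | side e == b].
(* A half has at most [h + 1] vertices, and [(h + 1) * d <= (d + 1) * h] because [d <= h]. Hence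
   each side is cut into at most [d + 1] blocks of size [h]. *)
have on_side_card b : #|on_side b| <= d.+1 * h.
  have -> : #|on_side b| = \sum_(w in half b) #|[set e in on_side b | y e == w]|.
    rewrite -sum1_card (partition_big y (mem (half b))) => [|e]; last first.
      by rewrite inE /half /side => /eqP <-; case: ifP => //=; rewrite inE yB => ->.
    by apply: eq_bigr => w _; rewrite -sum1_card; apply: eq_bigl => e; rewrite !inE.
  have : \sum_(w in half b) #|[set e in on_side b | y e == w]| <= \sum_(w in half b) d.
    apply: leq_sum => w _; apply: leq_trans (yd w); apply: subset_leq_card.
    by apply/subsetP => e; rewrite !inE => /andP[].
  rewrite sum_nat_const => /leq_trans; apply.
  have /andP[_ /leq_mul/(_ (leqnn d))/leq_trans] := half_card b; apply.
  by rewrite mulSn mulSn [h * d]mulnC leq_add2r.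
pose idx e := index e (enum (on_side (side e))).
have idx_inj e f : side e = side f -> idx e = idx f -> e = f.
  move=> sef; rewrite /idx sef => ief.
  by rewrite -(nth_index e (_ : e \in enum (on_side (side f)))) ?ief ?nth_index //
     mem_enum inE ?sef.
have idx_lt e : idx e < d.+1 * h.
  apply: leq_trans (on_side_card (side e)).
  by rewrite cardE index_mem mem_enum inE.
have h_gt0 (e : E) : 0 < h.
  by apply: leq_trans (xh e); apply/card_gt0P; exists e; rewrite inE.
have [e _|e _|k kh kP] := @konig_edge_colouring E _ _
    (fun e => (side e, x e)) (fun e => (side e, idx e %/ h)) [set: E] h.
- apply: leq_trans (xh e); apply: subset_leq_card.
  by apply/subsetP => f; rewrite !inE xpair_eqE /= => /andP[_ ->].
- apply: (@leq_trans ((idx e %/ h).+1 * h - idx e %/ h * h)); last by rewrite mulSn addnK.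
  apply: (@card_le_interval _ _ idx) => [f g|f]; rewrite !inE !xpair_eqE /=.
    by move=> /andP[/eqP sf _] /andP[/eqP sg _]; apply: idx_inj; rewrite sf sg.
  move=> /andP[_ /eqP <-].
  by rewrite leq_divM ltn_ceil // (h_gt0 e).
(* The colour of [e] selects a vertex of the opposite half. The default [y e] is never taken, as
   each half has at least [h] vertices. *)
pose u e := nth (y e) (enum (half (~~ side e))) (k e).
have k_lt e : k e < size (enum (half (~~ side e))).
  rewrite -cardE; apply: leq_trans (kh e (in_setT e)) _.
  by case/andP: (half_card (~~ side e)).
have u_half e : u e \in half (~~ side e) by rewrite -mem_enum mem_nth.
have uH e : (u e \in H) = ~~ side e.
  by have /half_mem/andP[_ /eqP] := u_half e.
have u_inj e f : u e = u f -> side e = side f /\ k e = k f.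
  move=> uef; have sef : side e = side f by apply: negb_inj; rewrite -!uH uef.
  split=> //; apply/eqP; have := uef; rewrite /u sef => /eqP.
  rewrite (set_nth_default (y f)) ?nth_uniq ?enum_uniq -?sef //.
  by rewrite sef.
exists H, u; split=> //.
- by move=> e; have /half_mem/andP[] := u_half e.
- move=> e f /u_inj[sef kef] xef.
  by apply: kP; rewrite ?in_setT // /share sef xef eqxx.
(* Edges with the same [u] agree in side and colour, hence lie in distinct blocks. *)
- move=> w; rewrite -[d.+1]subn0.
  apply: (@card_le_interval _ _ (fun e => idx e %/ h)) => [e f|e]; rewrite !inE.
    move=> /eqP ue /eqP uf bef; have [sef kef] := u_inj e f (etrans ue (esym uf)).
    by apply: kP; rewrite ?in_setT // /share sef bef eqxx orbT.
  by move=> _; rewrite /= ltn_divLR ?(h_gt0 e).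
Qed.

(** The last three conclusions exclude a common edge of two paths [x u v y]: between two first
    edges, between a first edge and a later one, and between two later ones. *)
Lemma routing (A B : {set V}) :
  (forall e, x e \in A) -> (forall e, y e \in B) ->
  (forall w, #|[set e | y e == w]| <= d) ->
  (forall e, #|[set f | x f == x e]| <= #|B|./2) ->
  d <= #|B|./2 -> 4 * d + 3 <= #|A| ->
  exists u v : E -> V,
    [/\ forall e, [&& u e \in B, v e \in A, u e != y e & v e != x e],
        forall e f, u e = u f -> x e = x f -> e = f,
        forall e f, v f = x e -> u e != u f /\ u e != y f &
        forall e f, v e = v f -> [|| u e == u f, y e == y f | u e == y f] -> e = f].
Proof.
move=> xA yB yd xh dh dA.
have [H [u [uB uH ux ud]]] := balanced_crossing yB yd xh dh.
(* [p e] is the one of [u e], [y e] inside [H], and [q e] the one outside, so the pairs form a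
   bipartite multigraph. *)
pose p e := if y e \in H then y e else u e.
pose q e := if y e \in H then u e else y e.
pose used w := x @: [set f | u f == w].
have used_card w : #|used w| <= d.+1 by apply: leq_trans (leq_imset_card _ _) (ud w).
have ends_card (r : E -> V) w : (forall f, r f = y f \/ r f = u f) ->
    #|[set f | r f == w]| <= d + d.+1.
  move=> ryu; apply: leq_trans (leq_add (yd w) (ud w)).
  apply: leq_trans (leq_card_setU _ _); apply: subset_leq_card.
  by apply/subsetP => f; rewrite !inE; case: (ryu f) => -> ->; rewrite ?orbT.
(* Degrees are at most [d + (d + 1)], and at most [2 * (d + 1)] colours are forbidden; [4 * d + 3]
   is the sum of the two bounds. *)
have [e|e|e|v vL vP] := @galvin E V V p q V (d + d.+1)
    (fun e => A :\: (used (u e) :|: used (y e))).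
- by apply: ends_card => f; rewrite /p; case: ifP; auto.
- by apply: ends_card => f; rewrite /q; case: ifP; auto.
- rewrite cardsD; set U := _ :|: _.
  have : #|A :&: U| <= #|U| by apply: subset_leq_card; apply: subsetIr.
  have := leq_of_leqif (leq_card_setU (used (u e)) (used (y e))).
  have := used_card (u e); have := used_card (y e); rewrite -/U; lia.
have vfree e f : v f = x e -> u e != u f /\ u e != y f.
  move=> vx; have := vL f; rewrite !inE negb_or vx => /andP[/andP[n1 n2] _].
  by split; [apply: contra n1 | apply: contra n2] => eqw; apply/imsetP; exists e;
     rewrite ?inE.
exists u, v; split=> //.
- move=> e; rewrite uB /=; have := vL e; rewrite inE => /andP[_ -> /=].
  apply/andP; split.
    by apply/eqP => uy; have := uH e; rewrite uy; case: (y e \in H).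
  by apply/eqP => /vfree[]; rewrite eqxx.
- move=> e f vef ef; apply: vP vef _; have := uH e; have := uH f.
  rewrite /share /p /q; case/or3P: ef => /eqP -> .
  + by case: (y e \in H) (y f \in H) => [] [] -> //=; rewrite eqxx ?orbT.
  + by case: (y f \in H); rewrite eqxx ?orbT.
  + by case: (y e \in H) (y f \in H) => [] [] //; rewrite eqxx ?orbT.
Qed.

End Routing.

(** * Edge-disjoint paths in the complete bipartite graph *)

Lemma set2_inj_across (V : finType) (A B : {set V}) (a b a' b' : V) :
  [disjoint A & B] -> a \in A -> b \in B -> a' \in A -> b' \in B ->
  [set a; b] = [set a'; b'] -> a = a' /\ b = b'.
Proof.
move=> dAB aA bB aA' bB' eqab.
have neq s t : s \in A -> t \in B -> (s == t) = false.
  by move=> sA tB; apply: contraFF (disjointFr dAB sA) => /eqP ->.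
split; apply/eqP.
  by have := set21 a b; rewrite eqab !inE (neq a b') // orbF.
by have := set22 a b; rewrite eqab !inE [b == a']eq_sym (neq a' b).
Qed.

(** Allows the smaller colour class to be taken as [A]. *)
Lemma resolvable_complete_bipartiteC (V : finType) (A B : {set V})
    (dAB : [disjoint A & B]) (dBA : [disjoint B & A]) (D : demand_graph V) :
  resolvable (complete_bipartite dAB) D -> resolvable (complete_bipartite dBA) D.
Proof.
case=> P [Ppath Pdisj]; exists P; split=> // e; have [/andP[Pe uPe] endsPe] := Ppath e.
split=> //; apply/andP; split=> //; rewrite -(eq_path (e := biadj A B)) // => s t.
by rewrite /= /biadj orbC.
Qed.

Lemma resolvable_complete_bipartite (V : finType) (A B : {set V})
    (dAB : [disjoint A & B]) (D : demand_graph V) (d : nat) :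
  bipartite_demand A B D ->
  {in A, forall x, degree D x <= #|B|./2} ->
  {in B, forall y, degree D y <= d} ->
  d <= #|B|./2 -> 4 * d + 3 <= #|A| ->
  resolvable (complete_bipartite dAB) D.
Proof.
move=> /fin_all_exists[x /fin_all_exists[y xyP]] degA degB dB dA.
have xA e : x e \in A by case: (xyP e).
have yB e : y e \in B by case: (xyP e).
have ends e : dends e = [set x e; y e] by case: (xyP e).
have [w|e|u [v [uvP uinj vx vinj]]] := @routing _ V x y d A B xA yB _ _ dB dA.
- have [wB|wB] := boolP (w \in B).
    apply: leq_trans (degB w wB); apply: subset_leq_card.
    by apply/subsetP => e; rewrite !inE ends !inE => /eqP ->; rewrite eqxx orbT.
  rewrite (_ : [set _ | _] = set0) ?cards0 //; apply/setP => e; rewrite !inE.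
  by apply: contraNF wB => /eqP <-.
- apply: leq_trans (degA _ (xA e)); apply: subset_leq_card.
  by apply/subsetP => f; rewrite !inE ends !inE => /eqP ->; rewrite eqxx.
have uB e : u e \in B by case/and4P: (uvP e).
have vA e : v e \in A by case/and4P: (uvP e).
have neq s t : s \in A -> t \in B -> (s == t) = false.
  by move=> sA tB; apply: contraFF (disjointFr dAB sA) => /eqP ->.
exists (fun e => (x e, [:: u e; v e; y e])); split=> [e|e f /eqP nef].
  case/and4P: (uvP e) => _ _ uy vxe; rewrite ends; split=> //.
  rewrite /is_gpath /= /biadj !inE xA uB vA yB ?orbT /=.
  rewrite [u e == v e]eq_sym [x e == v e]eq_sym (negbTE uy) (negbTE vxe).
  by rewrite !neq.
(* The edges of the path of [g], each with its end in [A] first: [x u], then [v u] or [v y]. *)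
pose uses g a b := a = x g /\ b = u g \/ a = v g /\ (b = u g \/ b = y g).
have usesP g s : s \in gpath_edges (x g, [:: u g; v g; y g]) ->
    exists a b, [/\ a \in A, b \in B, s = [set a; b] & uses g a b].
  rewrite /gpath_edges /= !inE => /or3P[] /eqP ->.
  - by exists (x g), (u g); split=> //; left.
  - by exists (v g), (u g); rewrite setUC; split=> //; right; auto.
  - by exists (v g), (y g); split=> //; right; auto.
rewrite disjoint_has; apply/hasPn => s /usesP[a [b [aA bB -> ue]]].
apply/negP => /usesP[a' [b' [aA' bB' /(set2_inj_across dAB) eqab uf]]].
have [eqa eqb] := eqab aA bB aA' bB'; subst a' b'; apply: nef.
case: ue uf => [[-> ->]|[-> eb]] [[]|[]].
- by move=> xef uef; apply: uinj.
- move=> /esym/vx[/eqP n1 /eqP n2]; by case.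
- by move=> vxf; move: eb; case: (vx f e vxf) => /eqP n1 /eqP n2 [] -> // /esym.
- move=> vef; case: eb => -> [] bf.
  + by apply: vinj vef _; rewrite bf eqxx.
  + by apply: vinj vef _; rewrite bf eqxx !orbT.
  + by apply/esym/vinj; rewrite // bf eqxx !orbT.
  + by apply: vinj vef _; rewrite bf eqxx orbT.
Qed.

(* The asymptotic degree bounds *)
From HB Require Import structures.
From mathcomp Require Import all_boot all_order all_algebra.
From mathcomp Require Import all_classical all_reals all_analysis.
Import Order.TTheory GRing.Theory Num.Theory.
Import numFieldNormedType.Exports.
Local Open Scope ring_scope.
From mathcomp Require Import lra.

(** As [harmonic m] is [1 / (m + 1)], the error term takes [6 * m / (m + 1)] from [m], which is at
    least 3 once [m] is positive. *)
Lemma nat_degree_bound (R : realType) (m k : nat) :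
  (0 < m)%N -> k%:R <= (1 - 6 * harmonic m) * m%:R / 4 :> R -> (4 * k + 3 <= m)%N.
Proof.
rewrite -(ler_nat R) -(ler_nat R (4 * k + 3)) natrD natrM /= => m1.
have -> : m.+1%:R = m%:R + 1 :> R by rewrite natr1.
have : 3 <= 6 * (m%:R + 1)^-1 * m%:R :> R.
  by rewrite mulrAC ler_pdivlMr; lra.
lra.
Qed.

Theorem theorem1 (R : realType) :
  exists eps : nat -> R,
    (forall m : nat, 0 <= eps m) /\
    (eps m @[m --> \oo] --> (0 : R))%classic /\
    (forall (V : finType) (A B : {set V}) (dAB : [disjoint A & B])
            (D : demand_graph V),
       A :|: B = [set: V]%SET ->
       bipartite_demand A B D ->
       (forall x : V, x \in A ->
          (degree D x)%:R <= (1 - eps #|B|) * #|B|%:R / 4) ->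
       (forall y : V, y \in B ->
          (degree D y)%:R <= (1 - eps #|A|) * #|A|%:R / 4) ->
       resolvable (complete_bipartite dAB) D).
Proof.
exists (fun m => 6 * harmonic m); split; first by move=> m; rewrite mulr_ge0 ?harmonic_ge0.
split; first by rewrite -[0 : R](mulr0 6); apply: cvgMr; apply: cvg_harmonic.
move=> V A B dAB D _ DAB degA degB.
(* A demand edge makes both classes nonempty, as [nat_degree_bound] requires; without one the empty
   assignment works. *)
have [e0 _|D0] := pickP (predT : pred (dedge D)); last first.
  by exists (fun e => False_rect _ (notF (esym (D0 e)))); split=> e; have := D0 e.
have [x0 [y0 [x0A y0B _]]] := DAB e0.
have A_gt0 : (0 < #|A|)%N by apply/card_gt0P; exists x0.
have B_gt0 : (0 < #|B|)%N by apply/card_gt0P; exists y0.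
have natA x (xA : x \in A) := nat_degree_bound B_gt0 (degA x xA).
have natB y (yB : y \in B) := nat_degree_bound A_gt0 (degB y yB).
have [AB|/ltnW BA] := leqP #|A| #|B|.
  (* The largest [d] with [4 * d + 3 <= #|A|]. The bound at [y0] gives [3 <= #|A|], so the
     subtraction is not truncated. *)
  apply: (@resolvable_complete_bipartite _ _ _ _ _ ((#|A| - 3) %/ 4)%N) => //.
  - by move=> x /natA; lia.
  - by move=> y /natB; lia.
  - by lia.
  - by have := natB y0 y0B; lia.
have dBA : [disjoint B & A] by rewrite disjoint_sym.
apply: (@resolvable_complete_bipartiteC _ B A dBA).
apply: (@resolvable_complete_bipartite _ _ _ _ _ ((#|B| - 3) %/ 4)%N).
- by move=> e; have [x [y [xA yB ->]]] := DAB e; exists y, x; rewrite finset.setUC.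
- by move=> y /natB; lia.
- by move=> x /natA; lia.
- by lia.
- by have := natA x0 x0A; lia.
Qed.
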